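(* Let $A: L^2(0,1)\to\ell^2$ be given by $[Ax]_j=\int_0^1 t^{j-1}x(t)\,dt$, $j=1,2,\dots$. There exist constants $C>0$ and $c_0>0$ such that for every $E>0$ and every $x\in H^1(0,1)$ with $\|x\|_{H^1(0,1)}\le E$, setting $\delta=\|Ax\|_{\ell^2}$, if $0<\delta/E\le c_0$ then $$\|x\|_{L^2(0,1)}\le \frac{7}{\sqrt 8}\,E\left(-\ln\left(C\frac{\delta}{E}\right)\right)^{-1}.$$ Consequently, $$\sup\left\{\|x\|_{L^2(0,1)} : x\in H^1(0,1),\ \|x\|_{H^1(0,1)}\le 1,\ \|Ax\|_{\ell^2}\le\delta\right\}=\mathcal{O}\left(\frac{1}{\ln(1/\delta)}\right)\quad\text{as }\delta\to 0.$$
   Context: $A$ is a bounded injective linear operator from the real Hilbert space $L^2(0,1)$ to the real Hilbert space $\ell^2$ of square summable sequences indexed by $j=1,2,\dots$. $H^1(0,1)$ is the Sobolev space with norm $\|x\|_{H^1(0,1)}^2=\|x\|_{L^2(0,1)}^2+\|x'\|_{L^2(0,1)}^2$. *)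

(* Defs.v *)
From HB Require Import structures.
From mathcomp Require Import all_boot all_order all_algebra.
From mathcomp Require Import all_classical all_reals all_analysis.

Set Implicit Arguments.
Unset Strict Implicit.
Unset Printing Implicit Defensive.
Import Order.TTheory GRing.Theory Num.Theory.
Import numFieldNormedType.Exports.

Local Open Scope classical_set_scope.
Local Open Scope ring_scope.

(* Elements of L^2(0,1) are handled through representatives [x : R -> R]: only
   the restriction of [x] to ]0, 1[ matters, and it is extended by zero
   ([x \_ `]0, 1[]) to be measured by the L^2 norm of the line. *)
Definition L2 (R : realType) : set (R -> R) :=
  [set x | x \_ `]0, 1[ \in Lfun (@lebesgue_measure R) 2%:E].

Definition L2norm (R : realType) (x : R -> R) : R :=
  fine ('N[@lebesgue_measure R]_2%:E[EFin \o (x \_ `]0, 1[)]).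

(* C_c^oo(0,1), each function being extended by zero to the line. *)
Definition test_function (R : realType) : set (R -> R) :=
  [set phi | (forall n t, derivable (phi^`(n))%classic t 1) /\
             compact (closure [set t | phi t != 0]) /\
             closure [set t | phi t != 0] `<=` `]0, 1[].

Definition is_weak_derivative (R : realType) (x y : R -> R) : Prop :=
  L2 y /\
  forall phi, test_function phi ->
    \int[@lebesgue_measure R]_(t in `]0, 1[) (x t * phi^`()%classic t) =
    - \int[@lebesgue_measure R]_(t in `]0, 1[) (y t * phi t).

Definition H1 (R : realType) : set (R -> R) :=
  [set x | L2 x /\ exists y, is_weak_derivative x y].

(* Some weak derivative of [x], when there is one; two of them agree almost
   everywhere on ]0, 1[, so that the choice does not affect [H1norm]. *)
Definition weak_derivative (R : realType) (x : R -> R) : R -> R :=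
  xget (cst 0) [set y | is_weak_derivative x y].

Definition H1norm (R : realType) (x : R -> R) : R :=
  Num.sqrt (L2norm x ^+ 2 + L2norm (weak_derivative x) ^+ 2).

(* The norm of l^2 as the L^2 norm for the counting measure on [nat]; it is
   extended-real, being +oo exactly on the sequences outside l^2. *)
Definition l2norm (R : realType) (a : nat -> R) : \bar R :=
  'N[@counting nat R]_2%:E[EFin \o a].

(* Sequences are numbered from 0, so that the component [j : nat] below is the
   moment of order [j], written [Ax]_(j+1) when sequences start at 1. *)
Definition moment_op (R : realType) (x : R -> R) : nat -> R :=
  fun j => \int[@lebesgue_measure R]_(t in `]0, 1[) (t ^+ j * x t).

(* Main.v *)
(* Let P_k be the shifted Legendre polynomials, orthogonal on (0,1) with
   |P_k|^2 = 1 / (2k+1), a_k = <x, P_k>, and v = t (1 - t).  Since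
   (v P_k')' = - k (k+1) P_k, integrating by parts against the weak derivative y
   of x controls the tail: sum_(k >= n) (2k+1) a_k^2 <= |y|^2 / (4 n^2).  The
   coefficients of P_k have absolute sum at most 8^k, so if all the moments of x
   are bounded by d, then |a_k| <= 8^k d.  As polynomials are dense in L^2,
   |x|^2 <= n^2 64^n d^2 + |y|^2 / (4 n^2) for every n > 0, and the choice
   n ~ ln(E/d) / 3 gives the logarithmic rate, even with C = 1. *)

Require Import Defs.
From HB Require Import structures.
From mathcomp Require Import all_boot all_order all_algebra.
From mathcomp Require Import all_classical all_reals all_analysis.
From mathcomp Require Import ring lra measurable_realfun.

Set Implicit Arguments.
Unset Strict Implicit.
Unset Printing Implicit Defensive.
Import Order.TTheory GRing.Theory Num.Theory.
Import numFieldNormedType.Exports.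

Local Open Scope classical_set_scope.
Local Open Scope ring_scope.

(** * The inner product of L^2(0,1) *)

Section SquareIntegrable.
Context {R : realType}.
Local Notation mu := (@lebesgue_measure R).
Local Notation D := (`]0%R, 1%R[%classic : set R).
Implicit Types f g h : R -> R.

(** The obstacle is the integration by parts: a weak derivative is only known against smooth
    functions with compact support in []0, 1[], whereas [v P_k'] merely vanishes at the ends.
    Explicit cut-offs built from [exp (- e / u)] bridge the gap, so that no trace of [x] at 0 or 1
    enters the argument. In the tail bound, the 4 comes from [v <= 1/4] and [n^2] from
    [k (k+1) >= n^2]. Only the inequality half of Parseval that rests on density is used, and
    density itself is obtained from polynomials converging to step functions, followed by a Dynkin
    class argument. The constant [7 / sqrt 8] leaves some room: the two error terms add up to
    [6 / L^2] with [L = ln (E/d)], and [6 <= 49/8]. *)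

Definition sq_integrable f : Prop :=
  measurable_fun D f /\ mu.-integrable D (EFin \o (fun t => f t ^+ 2)).

Definition ip f g : R := \int[mu]_(t in D) (f t * g t).

Lemma measurable_unit_itv : measurable D. Proof. exact: measurable_itv. Qed.
Hint Resolve measurable_unit_itv : core.

Lemma lebesgue_measure_unit_itv : mu D = 1%:E.
Proof. by rewrite lebesgue_measure_itv /= lte_fin ltr01 oppr0 addr0. Qed.

Lemma restrict_sqr f : (fun t => (f \_ D) t ^+ 2) = (fun t => f t ^+ 2) \_ D.
Proof.
by apply/funext => t; rewrite !patchE; case: ifP => // _; rewrite expr0n.
Qed.

Lemma Lnorm2_restrict f :
  ('N[mu]_2%:E[EFin \o (f \_ D)] = (\int[mu]_(t in D) (f t ^+ 2)%:E) `^ 2^-1)%E.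
Proof.
rewrite unlock [in RHS]integral_mkcond; congr poweR.
apply: eq_integral => t _ /=; rewrite !patchE; case: ifP => _ /=.
  by rewrite powR_mulrn// real_normK// num_real.
by rewrite normr0 powR0.
Qed.

(** Trades the zero extension to the line for integrals over []0, 1[], the form in which [ip] is
    bilinear. *)
Lemma L2P f : L2 f <-> sq_integrable f.
Proof.
split.
- rewrite /L2 /= => L2f; split.
    move: L2f; rewrite inE => /andP[/[!inE]/= mf _].
    by apply/(measurable_restrictT f).
  apply/integrable_mkcond => //.
  have := Lfun2_integrable_sqr L2f.
  by rewrite restrict_sqr -restrict_EFin.
- move=> [mf f2]; rewrite /L2 /= inE; apply/andP; split; rewrite inE /=.
    by apply/(measurable_restrictT f).
  rewrite /finite_norm Lnorm2_restrict poweR_lty//.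
  by have /integrable_lty := f2; apply.
Qed.

Lemma L2normE f : L2 f -> L2norm f = Num.sqrt (ip f f).
Proof.
move=> /L2P[mf f2]; rewrite /L2norm Lnorm2_restrict /ip /Rintegral.
have /fineK <- : (\int[mu]_(t in D) (f t ^+ 2)%:E)%E \is a fin_num.
  exact: integrable_fin_num.
by rewrite poweR_EFin /= powR12_sqrt ?fine_ge0 ?integral_ge0// => t _;
  rewrite lee_fin sqr_ge0.
Qed.

Lemma L2norm_ge0 f : 0 <= L2norm f.
Proof. by rewrite fine_ge0// Lnorm_ge0. Qed.

Lemma ip_ge0 f : 0 <= ip f f.
Proof. by apply: Rintegral_ge0 => t _; rewrite -expr2 sqr_ge0. Qed.

Lemma L2norm_sqr f : L2 f -> L2norm f ^+ 2 = ip f f.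
Proof. by move=> /L2normE ->; rewrite sqr_sqrtr ?ip_ge0. Qed.

Lemma sq_integrableM f g : sq_integrable f -> sq_integrable g ->
  mu.-integrable D (EFin \o (fun t => f t * g t)).
Proof.
move=> [mf f2] [mg g2].
apply: (@le_integrable _ _ _ mu D measurable_unit_itv _
  (fun t => (f t ^+ 2)%R%:E + (g t ^+ 2)%R%:E)%E).
- by apply/measurable_EFinP; exact: measurable_funM.
- move=> t _ /=; rewrite lee_fin normrM [leRHS]ger0_norm; last first.
    by rewrite addr_ge0 ?sqr_ge0.
  rewrite -[f t ^+ 2]real_normK ?num_real// -[g t ^+ 2]real_normK ?num_real//.
  have := sqr_ge0 (`|f t| - `|g t|); have := normr_ge0 (f t).
  by have := normr_ge0 (g t); nra.
- exact: integrableD.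
Qed.

Lemma sq_integrableD f g : sq_integrable f -> sq_integrable g ->
  sq_integrable (fun t => f t + g t).
Proof.
move=> sf sg; have fg := sq_integrableM sf sg; case: sf sg => [mf f2] [mg g2].
split; first exact: measurable_funD.
apply: (@eq_integrable _ _ _ mu D measurable_unit_itv (fun t => (f t ^+ 2)%R%:E +
  ((g t ^+ 2)%R%:E + ((f t * g t)%R%:E + (f t * g t)%R%:E)))%E).
  by move=> t _ /=; congr EFin; ring.
by do 2 (apply: integrableD => //); exact: integrableD.
Qed.

Lemma sq_integrableZ (c : R) f :
  sq_integrable f -> sq_integrable (fun t => c * f t).
Proof.
move=> [mf f2]; split; first exact: measurable_funM.
apply: (@eq_integrable _ _ _ mu D measurable_unit_itv
  (fun t => (c ^+ 2)%R%:E * (f t ^+ 2)%R%:E)%E).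
  by move=> t _ /=; rewrite exprMn.
exact: integrableZl.
Qed.

Lemma sq_integrableB f g : sq_integrable f -> sq_integrable g ->
  sq_integrable (fun t => f t - g t).
Proof.
move=> sf sg; have := sq_integrableD sf (sq_integrableZ (-1) sg).
by under eq_fun do rewrite mulN1r.
Qed.

Lemma bounded_integrable f (c : R) : measurable_fun D f ->
  (forall t, D t -> `|f t| <= c) -> mu.-integrable D (EFin \o f).
Proof.
move=> mf fc; apply: measurable_bounded_integrable => //.
  by rewrite [X in (X < _)%E](_ : _ = 1%:E) ?ltry//; exact: lebesgue_measure_unit_itv.
by exists c; split; [exact: num_real|move=> M cM t Dt;
  rewrite /= (le_trans (fc _ Dt))// ltW].
Qed.

Lemma bounded_sq_integrable f (c : R) : measurable_fun D f ->
  (forall t, D t -> `|f t| <= c) -> sq_integrable f.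
Proof.
move=> mf fc; split => //.
apply: (@bounded_integrable _ (c ^+ 2)); first exact: measurable_funX.
move=> t Dt; rewrite normrX ler_sqr ?nnegrE//; first exact: fc.
exact: le_trans (fc _ Dt).
Qed.

Lemma ipC f g : ip f g = ip g f.
Proof. by apply: eq_Rintegral => t _; rewrite mulrC. Qed.

Lemma ipDr f g h : sq_integrable f -> sq_integrable g -> sq_integrable h ->
  ip f (fun t => g t + h t) = ip f g + ip f h.
Proof.
move=> sf sg sh; rewrite /ip; under eq_Rintegral do rewrite mulrDr.
by rewrite RintegralD//; exact: sq_integrableM.
Qed.

Lemma ipZr (c : R) f g : sq_integrable f -> sq_integrable g ->
  ip f (fun t => c * g t) = c * ip f g.
Proof.
move=> sf sg; rewrite /ip; under eq_Rintegral do rewrite mulrCA.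
by rewrite RintegralZl//; exact: sq_integrableM.
Qed.

Lemma ipBr f g h : sq_integrable f -> sq_integrable g -> sq_integrable h ->
  ip f (fun t => g t - h t) = ip f g - ip f h.
Proof.
move=> sf sg sh; rewrite /ip; under eq_Rintegral do rewrite mulrBr.
by rewrite RintegralB//; exact: sq_integrableM.
Qed.

Lemma ip_sqrB f g : sq_integrable f -> sq_integrable g ->
  ip (fun t => f t - g t) (fun t => f t - g t) = ip f f - 2 * ip f g + ip g g.
Proof.
move=> sf sg; have sfg := sq_integrableB sf sg.
rewrite ipBr// (ipC _ f) (ipC _ g) !ipBr// (ipC g f); ring.
Qed.

Lemma ip_sqrD f g : sq_integrable f -> sq_integrable g ->
  ip (fun t => f t + g t) (fun t => f t + g t) = ip f f + 2 * ip f g + ip g g.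
Proof.
move=> sf sg; have sfg := sq_integrableD sf sg.
rewrite ipDr// (ipC _ f) (ipC _ g) !ipDr// (ipC g f); ring.
Qed.

Lemma ip_sqrD_le f g : sq_integrable f -> sq_integrable g ->
  ip (fun t => f t + g t) (fun t => f t + g t) <= 2 * ip f f + 2 * ip g g.
Proof.
move=> sf sg; rewrite ip_sqrD//.
have := ip_ge0 (fun t => f t - g t); rewrite ip_sqrB//; lra.
Qed.

Lemma cauchy_schwarz f g : sq_integrable f -> sq_integrable g ->
  ip f g ^+ 2 <= ip f f * ip g g.
Proof.
move=> sf sg.
have key (c : R) : 0 <= ip f f - 2 * c * ip f g + c ^+ 2 * ip g g.
  have := ip_ge0 (fun t => f t - c * g t).
  have sc := sq_integrableZ c sg.
  rewrite ip_sqrB// !ipZr// (ipC (fun t => c * g t) g) ipZr//; lra.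
have [gg0|gg0] := eqVneq (ip g g) 0.
  have [->|fg0] := eqVneq (ip f g) 0; first by rewrite gg0 mulr0 expr0n.
  (* With [ip g g = 0] the quadratic in [c] is affine; this [c] gives it the value -1, a
     contradiction. *)
  have := key ((ip f f + 1) / (2 * ip f g)); rewrite gg0 mulr0 addr0.
  have -> : 2 * ((ip f f + 1) / (2 * ip f g)) * ip f g = ip f f + 1 by field.
  lra.
have gp : 0 < ip g g by rewrite lt_neqAle eq_sym gg0 ip_ge0.
have := key (ip f g / ip g g).
have -> : ip f f - 2 * (ip f g / ip g g) * ip f g +
    (ip f g / ip g g) ^+ 2 * ip g g = (ip f f * ip g g - ip f g ^+ 2) / ip g g.
  by field.
by rewrite pmulr_lge0 ?invr_gt0// subr_ge0.
Qed.

End SquareIntegrable.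

(** * Shifted Legendre polynomials *)

Section PolynomialIntegral.
Context {R : realType}.
Local Notation mu := (@lebesgue_measure R).
Local Notation D := (`]0%R, 1%R[%classic : set R).
Implicit Types p q r : {poly R}.

Lemma horner_le_coef p t : 0 <= t <= 1 ->
  `|p.[t]| <= \sum_(i < size p) `|p`_i|.
Proof.
move=> /andP[t0 t1]; rewrite horner_coef (le_trans (ler_norm_sum _ _ _))//.
apply: ler_sum => i _; rewrite normrM ler_piMr// normrX ger0_norm//.
exact: exprn_ile1.
Qed.

Lemma measurable_horner p (A : set R) : measurable_fun A (horner p).
Proof. exact: measurable_poly. Qed.

Lemma unit_itv_bounds t : D t -> 0 <= t <= 1.
Proof. by rewrite /= in_itv/= => /andP[t0 t1]; rewrite !ltW. Qed.

Lemma sq_integrable_horner p : sq_integrable (horner p).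
Proof.
apply: (@bounded_sq_integrable _ _ (\sum_(i < size p) `|p`_i|)).
  exact: measurable_horner.
by move=> t /unit_itv_bounds; exact: horner_le_coef.
Qed.

Definition pint p : R := \int[mu]_(t in D) p.[t].

Lemma integrable_horner p : mu.-integrable D (EFin \o horner p).
Proof.
apply: (@bounded_integrable _ _ (\sum_(i < size p) `|p`_i|)).
  exact: measurable_horner.
by move=> t /unit_itv_bounds; exact: horner_le_coef.
Qed.

Lemma pintD p q : pint (p + q) = pint p + pint q.
Proof.
rewrite /pint; under eq_Rintegral do rewrite hornerD.
by rewrite RintegralD//; try exact: integrable_horner; exact: measurable_unit_itv.
Qed.

Lemma pintZ c p : pint (c *: p) = c * pint p.
Proof.
rewrite /pint; under eq_Rintegral do rewrite hornerZ.
by rewrite RintegralZl//; try exact: integrable_horner; exact: measurable_unit_itv.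
Qed.

Lemma pint_linear : linear (pint : {poly R} -> R^o).
Proof. by move=> c p q; rewrite pintD pintZ. Qed.

HB.instance Definition _ :=
  GRing.isLinear.Build R {poly R} R^o _ pint pint_linear.

Lemma pintB p q : pint (p - q) = pint p - pint q.
Proof. exact: (raddfB pint). Qed.

Lemma pint_sum I (s : seq I) (P : pred I) (F : I -> {poly R}) :
  pint (\sum_(i <- s | P i) F i) = \sum_(i <- s | P i) pint (F i).
Proof. exact: (raddf_sum pint). Qed.

Lemma pint_deriv p : pint p^`() = p.[1] - p.[0].
Proof.
rewrite /pint /Rintegral integral_itv_obnd_cbnd; last first.
  by apply/measurable_EFinP; exact: measurable_horner.
rewrite integral_itv_bndo_bndc; last first.
  by apply/measurable_EFinP; exact: measurable_horner.
rewrite (@continuous_FTC2 _ _ (horner p))//.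
- by apply/continuous_subspaceT => t; exact: continuous_horner.
- split=> [t _| |]; first exact: derivable_horner.
  + by apply: cvg_at_right_filter; exact: continuous_horner.
  + by apply: cvg_at_left_filter; exact: continuous_horner.
- by move=> t _; rewrite -derivE.
Qed.

Lemma ip_horner p q : ip (horner p) (horner q) = pint (p * q).
Proof. by apply: eq_Rintegral => t _; rewrite hornerM. Qed.

Lemma pint_ge0 p : (forall t, 0 <= t <= 1 -> 0 <= p.[t]) -> 0 <= pint p.
Proof. by move=> p0; apply: Rintegral_ge0 => t /unit_itv_bounds /p0. Qed.

(** Its zeros at 0 and 1 remove the boundary terms, both for polynomials and for weak
    derivatives. *)
Definition bubble : {poly R} := 'X - 'X^2.

Lemma horner_bubble t : bubble.[t] = t * (1 - t).
Proof. by rewrite /bubble !hornerE expr2; ring. Qed.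

Definition legendre_op p : {poly R} := (bubble * p^`())^`().

Lemma pint_legendre_op p q :
  pint (legendre_op p * q) = - pint (bubble * p^`() * q^`()).
Proof.
have := pint_deriv (bubble * p^`() * q).
rewrite !hornerM !horner_bubble subrr mulr0 !mul0r subrr derivM pintD.
by move/eqP; rewrite addr_eq0 => /eqP.
Qed.

Lemma legendre_op_sym p q : pint (legendre_op p * q) = pint (p * legendre_op q).
Proof.
rewrite [in RHS]mulrC !pint_legendre_op; congr (- pint _).
by rewrite -!mulrA [q^`() * _]mulrC.
Qed.

Lemma legendre_op_is_linear : linear legendre_op.
Proof.
move=> c p q; rewrite /legendre_op derivD derivZ mulrDr derivD.
by rewrite -scalerAr derivZ.
Qed.

HB.instance Definition _ := GRing.isLinear.Build R {poly R} {poly R} _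
  legendre_op legendre_op_is_linear.

Lemma legendre_opXn n :
  legendre_op 'X^n = (n ^ 2)%:R *: 'X^(n.-1) - (n * n.+1)%:R *: 'X^n.
Proof.
rewrite /legendre_op derivXn; case: n => [|n] /=.
  by rewrite !mulr0n !scale0r mulr0 deriv0 subrr.
have -> : bubble * ('X^n *+ n.+1) = ('X^(n.+1) - 'X^(n.+2)) *+ n.+1.
  by rewrite /bubble mulrnAr mulrBl -exprS -exprD.
rewrite derivMn derivB !derivXn /= !scaler_nat mulrnBl -!mulrnA mulnn.
by rewrite [(n.+1 * n.+2)%N]mulnC.
Qed.

(** The operator is bidiagonal on monomials, so the eigenvalue equation becomes a two-term recursion
    on coefficients. *)
Lemma coef_legendre_op p j :
  (legendre_op p)`_j = (j.+1 ^ 2)%:R * p`_j.+1 - (j * j.+1)%:R * p`_j.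
Proof.
rewrite -[p in LHS](coefK p) poly_def linear_sum /= coef_sum.
have E (i : nat) : (legendre_op (p`_i *: 'X^i))`_j =
    (if i == j.+1 then (j.+1 ^ 2)%:R * p`_j.+1 else 0) -
    (if i == j then (j * j.+1)%:R * p`_j else 0).
  rewrite linearZ /= coefZ legendre_opXn coefB !coefZ !coefXn mulrBr.
  congr (_ - _).
    case: (eqVneq i j.+1) => [->|ij]; first by rewrite /= eqxx mulr1 mulrC.
    case: i ij => [|i] ij; first by rewrite /= mul0r mulr0.
    by rewrite /= -[j == i]eqSS eq_sym (negPf ij) !mulr0.
  rewrite [j == i]eq_sym; case: (eqVneq i j) => [->|ij]; first by rewrite mulr1 mulrC.
  by rewrite !mulr0.
under eq_bigr do rewrite E.
rewrite sumrB -!big_mkcond /=.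
have F (k : nat) (c : R) :
    \sum_(i < size p | i == k :> nat) c * p`_k = c * p`_k.
  have [kp|pk] := ltnP k (size p).
    by rewrite (big_pred1 (Ordinal kp)).
  by rewrite nth_default// mulr0 big1.
by rewrite !F.
Qed.

(** This is [P_k (1 - 2 t)] for the classical Legendre polynomial [P_k] on [[-1, 1]]; this choice of
    sign gives the value 1 at 0. *)
Definition legendre k : {poly R} :=
  \poly_(j < k.+1) ((-1) ^+ j * ('C(k, j) * 'C(k + j, j))%:R).

Lemma coef_legendre k j :
  (legendre k)`_j = (-1) ^+ j * ('C(k, j) * 'C(k + j, j))%:R.
Proof.
rewrite coef_poly; case: ltnP => // kj.
by rewrite bin_small ?mul0n ?mulr0.
Qed.

(** Consecutive coefficients satisfy [(j+1)^2 c_(j+1) = - (k-j) (k+j+1) c_j], and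
    [(k-j) (k+j+1) = k (k+1) - j (j+1)]. *)
Lemma legendre_eigen k :
  legendre_op (legendre k) = - (k * k.+1)%:R *: legendre k.
Proof.
apply/polyP => j; rewrite coef_legendre_op coefZ !coef_legendre.
have [jk|kj] := leqP j k; last first.
  by rewrite ['C(k, j)]bin_small// bin_small ?ltnS 1?ltnW// !mul0n !mulr0 subrr.
have E1 : (j.+1 * 'C(k, j.+1) = (k - j) * 'C(k, j))%N by rewrite mul_bin_left.
have E2 : (j.+1 * 'C(k + j.+1, j.+1) = (k + j.+1) * 'C(k + j, j))%N.
  by rewrite addnS -mul_bin_diag.
have E : ((j.+1 ^ 2) * ('C(k, j.+1) * 'C(k + j.+1, j.+1)) =
          (k - j) * (k + j.+1) * ('C(k, j) * 'C(k + j, j)))%N.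
  by rewrite expnS expn1 mulnACA E1 E2 mulnACA.
rewrite mulrCA -natrM E exprS mulN1r.
rewrite natrM; set c := ('C(k, j) * 'C(k + j, j))%:R.
rewrite !natrM natrB// natrD -!natr1; ring.
Qed.

Lemma size_legendre k : size (legendre k) = k.+1.
Proof.
apply: size_poly_eq; rewrite mulf_neq0// ?signr_eq0//.
by rewrite pnatr_eq0 -lt0n muln_gt0 !bin_gt0 leqnn leq_addl.
Qed.

Lemma legendre0 k : (legendre k).[0] = 1.
Proof. by rewrite horner_coef0 coef_legendre !bin0 mulr1. Qed.

(** Symmetry of the operator ties the moment of order [n] to that of order [n - 1], with a factor
    that is nonzero for [n < k]. At [n = 0] the right-hand side is zero because of [0 ^ 2], which
    starts the induction. *)
Lemma legendre_orthoXn k i : (i < k)%N -> pint (legendre k * 'X^i) = 0.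
Proof.
have rec n : ((n * n.+1)%:R - (k * k.+1)%:R) * pint (legendre k * 'X^n) =
    (n ^ 2)%:R * pint (legendre k * 'X^(n.-1)).
  have := legendre_op_sym (legendre k) 'X^n.
  rewrite legendre_eigen legendre_opXn mulrBr -!scalerAr -scalerAl.
  rewrite pintB !pintZ; lra.
have neq n : (n < k)%N -> (n * n.+1)%:R - (k * k.+1)%:R != 0 :> R.
  move=> nk; rewrite subr_eq0 eqr_nat ltn_eqF//.
  by rewrite ltn_mul.
elim: i => [|i IH] ik; have := rec _; have nz := neq _ ik.
  by move=> /(_ 0%N) /eqP; rewrite mul0r mulf_eq0 (negPf nz) => /eqP.
move=> /(_ i.+1) /eqP; rewrite IH ?(ltnW ik)// mulr0 mulf_eq0 (negPf nz).
by move=> /eqP.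
Qed.

Lemma legendre_ortho_size k p : (size p <= k)%N -> pint (legendre k * p) = 0.
Proof.
move=> pk; rewrite -[p]coefK poly_def mulr_sumr pint_sum big1// => i _.
rewrite -scalerAr pintZ legendre_orthoXn ?mulr0//.
exact: leq_trans (ltn_ord i) pk.
Qed.

Lemma legendre_ortho j k : j != k -> pint (legendre j * legendre k) = 0.
Proof.
rewrite neq_ltn => /orP[jk|kj].
  by rewrite mulrC legendre_ortho_size ?size_legendre.
by rewrite legendre_ortho_size ?size_legendre.
Qed.

(* Integrate the derivative of [(1 - 'X) * P ^+ 2] for [P = legendre k]; up to
   lower degree terms, orthogonal to [P], [(1 - 'X) * P^`()] is [- k%:R *: P]. *)
Lemma legendre_sqr k : pint (legendre k ^+ 2) = (2 * k + 1)%:R^-1.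
Proof.
set P := legendre k.
have key : pint (P * ((1 - 'X) * P^`() + k%:R *: P)) = 0.
  apply: legendre_ortho_size; apply/leq_sizeP => j kj.
  rewrite mulrBl mul1r -commr_polyX coefD coefB coefZ coefMX !coef_deriv.
  have cP i : (k < i)%N -> P`_i = 0 by move=> ki; rewrite nth_default ?size_legendre.
  case: j kj => [|j] kj.
    move: kj; rewrite leqn0 => /eqP k0.
    by rewrite /= subr0 cP ?k0// mul0r ?mul0rn addr0.
  have z2 : P`_j.+2 = 0 by apply: cP.
  rewrite /= z2 mul0rn sub0r.
  move: kj; rewrite leq_eqVlt => /predU1P[->|kj]; first by rewrite mulr_natl addNr.
  by rewrite cP// mul0rn mulr0 oppr0 addr0.
have := pint_deriv ((1 - 'X) * (P * P)).
have X1 (c : R) : (1 - 'X : {poly R}).[c] = 1 - c by rewrite !hornerE.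
rewrite !hornerM !X1 subrr subr0 mul0r mul1r sub0r legendre0 mulr1.
have -> : ((1 - 'X) * (P * P))^`() =
   2 *: (P * ((1 - 'X) * P^`() + k%:R *: P)) - (2 * k + 1)%:R *: P ^+ 2.
  rewrite derivM derivB derivX derivC sub0r derivM -!mul_polyC.
  rewrite natrD natrM !rmorphD /= !rmorphM /= !rmorph1 /=. ring.
rewrite pintB !pintZ key mulr0 sub0r => /oppr_inj E.
apply: (@mulfI _ (2 * k + 1)%:R); first by rewrite pnatr_eq0 addn1.
by rewrite E divff// pnatr_eq0 addn1.
Qed.

(** Bound ['C(k + j, j)] by [2 ^ (k + j) <= 4 ^ k]; the remaining binomials sum to [2 ^ k]. *)
Lemma legendre_coef_sum k :
  \sum_(j < size (legendre k)) `|(legendre k)`_j| <= 8 ^+ k.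
Proof.
rewrite size_legendre.
apply: (@le_trans _ _ (\sum_(j < k.+1) ('C(k, j) * 4 ^ k)%:R)).
  apply: ler_sum => j _; rewrite coef_legendre normrM normrX normrN1 expr1n mul1r.
  rewrite normr_nat ler_nat leq_mul2l; apply/orP; right.
  have /(leq_trans _) -> // : (2 ^ (k + j) <= 4 ^ k)%N.
    by rewrite (_ : 4 = 2 ^ 2)%N// -expnM leq_exp2l// mul2n -addnn leq_add2l -ltnS.
  have hj : (j < (k + j).+1)%N by rewrite ltnS leq_addl.
  rewrite -[2%N]/(1 + 1)%N expnDn (bigD1 (Ordinal hj))//=.
  by rewrite !exp1n !muln1 leq_addr.
rewrite (_ : \sum_(j < k.+1) _ = ((\sum_(j < k.+1) 'C(k, j)) * 4 ^ k)%N%:R).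
  rewrite -natrX ler_nat.
  have := expnDn 1 1 k; under eq_bigr do rewrite !exp1n !muln1.
  by move=> <-; rewrite addn1 -expnMn.
by rewrite big_distrl /= natr_sum.
Qed.

Lemma legendre_span p n : (size p <= n)%N ->
  exists b : nat -> R, p = \sum_(k < n) b k *: legendre k.
Proof.
elim: n p => [|n IH] p pn.
  by exists (fun=> 0); rewrite big_ord0; apply/eqP; rewrite -size_poly_leq0.
have cn : (legendre n)`_n != 0.
  have := lead_coef_eq0 (legendre n); rewrite lead_coefE size_legendre /= => ->.
  by rewrite -size_poly_eq0 size_legendre.
pose c := p`_n / (legendre n)`_n.
have [] := IH (p - c *: legendre n).
  apply/leq_sizeP => j; rewrite leq_eqVlt => /predU1P[<-|nj].
    by rewrite coefB coefZ divfK// subrr.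
  rewrite coefB coefZ !nth_default ?size_legendre ?mulr0 ?subrr//.
  exact: leq_trans pn nj.
move=> b /eqP; rewrite subr_eq => /eqP E.
exists (fun k => if (k < n)%N then b k else c).
rewrite big_ord_recr /= ltnn E; congr (_ + _).
by apply: eq_bigr => i _; rewrite ltn_ord.
Qed.

End PolynomialIntegral.

(** * Dominated convergence for real-valued integrals *)

Section Convergence.
Context {R : realType}.
Local Notation mu := (@lebesgue_measure R).
Local Notation D := (`]0%R, 1%R[%classic : set R).

Lemma cvg_Rintegral (f_ : nat -> R -> R) (f g : R -> R) :
  (forall n, measurable_fun D (f_ n)) -> measurable_fun D f ->
  {ae mu, forall t, D t -> f_ n t @[n --> \oo] --> f t} ->
  mu.-integrable D (EFin \o g) ->
  (forall n t, D t -> `|f_ n t| <= g t) ->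
  \int[mu]_(t in D) f_ n t @[n --> \oo] --> \int[mu]_(t in D) f t.
Proof.
move=> mf_ mf ff ig fg.
have [] := @dominated_convergence _ _ _ mu D (@measurable_unit_itv R)
  (fun n => EFin \o f_ n) (EFin \o f) (EFin \o g).
- by move=> n; apply/measurable_EFinP; exact: mf_.
- exact/measurable_EFinP.
- apply: (@filterS _ _ (ae_filter_ringOfSetsType mu)) ff => t fft Dt.
  by apply/fine_cvgP; split; [exact: nearW|exact: fft].
- exact: ig.
- by apply: aeW => t n Dt /=; rewrite lee_fin fg.
move=> fi _ fcvg; apply: fine_cvg; rewrite fineK//.
by apply: integrable_fin_num => //; exact: measurable_unit_itv.
Qed.

Lemma cvg_lim_eq (f : nat -> R) (a b : R) :
  f n @[n --> \oo] --> a -> a = b -> f n @[n --> \oo] --> b.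
Proof. by move=> fa <-. Qed.

End Convergence.

(** * Smooth functions with compact support *)

Section TestFunctions.
Context {R : realType}.
Implicit Types (p q u : {poly R}) (t e : R).

(** Meant for the zeros of [u], where the two branches of [flat] below meet and no differentiation
    rule applies. *)
Lemma is_derive_quadratic (f : R -> R) t (c : R) : f t = 0 ->
  (\forall s \near t, `|f s| <= c * (s - t) ^+ 2) -> is_derive t 1 f 0.
Proof.
move=> ft0 /nbhs_ballP[d /= d0 fd].
have L : h^-1 *: ((f \o shift t) (h *: 1) - f t) @[h --> 0^'] --> (0 : R).
  apply/cvgr0Pnorm_le => e e0; near=> h.
  have h0 : h != 0 by near: h; exact: nbhs_dnbhs_neq.
  have hd : `|h| < d by near: h; exact: dnbhs0_lt.
  have he : `|h| <= e / (`|c| + 1).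
    by near: h; apply: dnbhs0_le; rewrite divr_gt0// ltr_wpDl.
  rewrite /= ft0 subr0 normrZ normfV scaler1.
  have : `|f (h + t)| <= c * h ^+ 2.
    have /fd : ball t d (h + t).
      by rewrite /ball /= opprD addrCA subrr addr0 normrN.
    by rewrite /= addrK.
  have hp : 0 < `|h| by rewrite normr_gt0.
  rewrite ler_pdivrMl// [`|h| * e]mulrC => /le_trans; apply.
  rewrite -real_normK ?num_real// expr2 mulrA ler_wpM2r//.
  rewrite ler_pdivlMr ?ltr_wpDl// in he.
  have := ler_norm c; nra.
by apply: DeriveDef; [apply/cvg_ex; exists 0|exact: cvg_lim L].
Unshelve. all: by end_near. Qed.

(* This family is stable under derivation, so its members are smooth. *)
Definition flat e u k q : R -> R := fun t =>
  if 0 < u.[t] then q.[t] / u.[t] ^+ k * expR (- (e / u.[t])) else 0.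

Lemma expRN_le (n : nat) (x : R) : 0 < x -> expR (- x) <= n.+1`!%:R / x ^+ n.+1.
Proof.
move=> x0; rewrite expRN -[leRHS]invf_div lef_pV2 ?posrE ?expR_gt0//.
  by apply: le_trans (expR_ge1Dxn n (ltW x0)); rewrite lerDr.
by rewrite divr_gt0 ?exprn_gt0// ltr0n fact_gt0.
Qed.

(** The bound [exp (- e / u) <= (k+2)! (u / e)^(k+2)] absorbs [u^-k] and still leaves the factor
    [u^2]. *)
Lemma flat_quadratic e u k q t : 0 < e ->
  `|flat e u k q t| <= `|q.[t]| * (k.+2`!%:R / e ^+ k.+2) * u.[t] ^+ 2.
Proof.
move=> e0; rewrite /flat; case: ifPn => [ut|_]; last first.
  rewrite normr0 mulr_ge0 ?sqr_ge0// mulr_ge0// divr_ge0// exprn_ge0//.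
  exact: ltW.
rewrite !normrM -!mulrA ler_wpM2l// normfV normrX (gtr0_norm ut).
rewrite (gtr0_norm (expR_gt0 _)) mulrC ler_pdivrMr ?exprn_gt0//.
apply: le_trans (expRN_le k.+1 _) _; first by rewrite divr_gt0.
have uE : u.[t] ^+ k.+2 = u.[t] ^+ k * u.[t] ^+ 2 by rewrite -exprD addn2.
by rewrite expr_div_n invf_div uE le_eqVlt; apply/orP; left; apply/eqP; ring.
Qed.

Lemma horner_bounded_near p t : \forall s \near t, `|p.[s]| <= `|p.[t]| + 1.
Proof.
have /cvgrPdist_le /(_ 1 ltr01) := @continuous_horner R p t.
apply: filterS => s ps; rewrite -lerBlDl (le_trans (lerB_dist _ _))//.
by rewrite distrC.
Qed.

(** Where [u < 0] the function is locally zero, and where [u > 0] this is the usual rule put over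
    the denominator [u^(k+2)]. At a zero [t] of [u], the factor [X - t] of [u] turns
    [flat_quadratic] into a bound by a multiple of [(s - t)^2]. *)
Lemma is_derive_flat e u k q t : 0 < e ->
  is_derive t 1 (flat e u k q)
    (flat e u k.+2 (u ^+ 2 * q^`() - k%:R *: (u * u^`() * q) +
                    e *: (u^`() * q)) t).
Proof.
move=> e0.
have cu : {for t, continuous (horner u)} by exact: continuous_horner.
have [ut|ut|ut] := ltgtP u.[t] 0.
- rewrite [X in is_derive _ _ _ X]/flat ltNge (ltW ut) /=.
  apply: (@near_eq_is_derive _ _ _ (cst 0)).
  have := cu; move=> /cvgr_lt /(_ 0 ut); apply: filterS => s us.
  by rewrite /flat ltNge (ltW us).
- pose w : R -> R := fun s => u.[s]^-1.
  have dw : is_derive t 1 w (- u.[t] ^- 2 *: u^`().[t]).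
    by apply: is_deriveV; rewrite gt_eqF.
  have de : is_derive t 1 (expR \o (- e \*: w))
     (expR (- e * w t) * (- e *: (- u.[t] ^- 2 *: u^`().[t]))).
    by apply: (@is_derive1_comp _ expR (- e \*: w)).
  apply: (@near_eq_is_derive _ _ _
    ((horner q * w ^+ k) * (expR \o (- e \*: w)))).
    have := cu; move=> /cvgr_gt /(_ 0 ut); apply: filterS => s us.
    by rewrite /flat us !fctE /= /w exprVn /GRing.scale /= mulNr.
  rewrite [X in is_derive _ _ _ X]/flat ut.
  apply: is_derive_eq.
  rewrite !fctE /= /w !hornerE /GRing.scale /= mulNr exprVn.
  have u0 : u.[t] != 0 by rewrite gt_eqF.
  move: (expR _) => Ex; case: k => [|k] /=; first by rewrite !expr0; field.
  have k0 : u.[t] ^+ k != 0 by rewrite expf_neq0.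
  have -> : u.[t] ^+ k.+3 = u.[t] ^+ k * u.[t] ^+ 3 by rewrite -exprD addn3.
  rewrite exprVn [u.[t] ^+ k.+1]exprS.
  by move: (u.[t] ^+ k) (k.+1%:R) k0 => X c X0; field; rewrite X0 u0.
- have ft : flat e u k q t = 0 by rewrite /flat ut ltxx.
  rewrite [X in is_derive _ _ _ X]/flat ut ltxx.
  have /factor_theorem[w uw] : root u t by apply/rootP.
  apply: (@is_derive_quadratic _ _
    ((`|q.[t]| + 1) * (k.+2`!%:R / e ^+ k.+2) * (`|w.[t]| + 1) ^+ 2)) => //.
  have := horner_bounded_near q t; apply: filterS2 (horner_bounded_near w t).
  move=> s ws qs; apply: le_trans (flat_quadratic u k q s e0) _.
  have c0 : 0 <= k.+2`!%:R / e ^+ k.+2.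
    by rewrite divr_ge0// exprn_ge0// ltW.
  rewrite uw hornerM hornerXsubC exprMn mulrA ler_wpM2r ?sqr_ge0//.
  apply: ler_pM; [exact: mulr_ge0|exact: sqr_ge0|by rewrite ler_wpM2r|].
  by rewrite -real_normK ?num_real// lerXn2r ?nnegrE ?addr_ge0.
Qed.

Lemma derive1_flat e u k q : 0 < e -> (flat e u k q)^`()%classic =
  flat e u k.+2 (u ^+ 2 * q^`() - k%:R *: (u * u^`() * q) + e *: (u^`() * q)).
Proof.
move=> e0; apply/funext => t; rewrite derive1E.
by have := is_derive_flat u k q t e0 => H; rewrite derive_val.
Qed.

Lemma derive1n_flat e u k q n : 0 < e -> exists q',
  ((flat e u k q)^`(n))%classic = flat e u (k + n * 2) q'.
Proof.
move=> e0; elim: n => [|n [q' E]]; first by exists q; rewrite addn0.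
by rewrite derive1nS E derive1_flat//; eexists; rewrite mulSn addnCA.
Qed.

Lemma flat_test_function e u k q : 0 < e ->
  (forall t, 0 <= u.[t] -> 0 < t < 1) -> test_function (flat e u k q).
Proof.
move=> e0 u01.
(* The support is where [u > 0] at most, hence its closure stays in the closed set [u >= 0], which
   lies inside []0, 1[]. *)
have cl : closure [set t | flat e u k q t != 0] `<=` [set t | 0 <= u.[t]].
  have cU : closed [set t | 0 <= u.[t]].
    rewrite (_ : [set t | _] = horner u @^-1` [set y | 0 <= y])//.
    by apply: closed_comp; [move=> t _; exact: continuous_horner|exact: closed_ge].
  rewrite [X in _ `<=` X](closure_id _).1//; apply: closure_subset => t /=.
  by rewrite /flat; case: ifPn => [/ltW//|_]; rewrite eqxx.
split; last split.
- move=> n t; have [q' ->] := derive1n_flat u k q n e0.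
  by have [] := is_derive_flat u (k + n * 2) q' t e0.
- apply: (@subclosed_compact _ _ (`[0%R, 1%R]%classic : set R)).
  + exact: closed_closure.
  + exact: segment_compact.
  + by move=> t /cl /= /u01 /andP[t0 t1]; rewrite in_itv /= !ltW.
- by move=> t /cl /= /u01; rewrite in_itv.
Qed.

End TestFunctions.

(** * Testing a weak derivative against polynomials vanishing at 0 and 1 *)

Section WeakDerivative.
Context {R : realType}.
Local Notation mu := (@lebesgue_measure R).
Local Notation D := (`]0%R, 1%R[%classic : set R).
Implicit Types (p q u : {poly R}) (t e : R) (x y : R -> R).

Lemma cvg_ip x (g_ : nat -> R -> R) (g : R -> R) (c : R) : sq_integrable x ->
  (forall n, measurable_fun D (g_ n)) -> measurable_fun D g ->
  (forall t, D t -> g_ n t @[n --> \oo] --> g t) ->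
  (forall n t, D t -> `|g_ n t| <= c) ->
  ip x (g_ n) @[n --> \oo] --> ip x g.
Proof.
move=> sx mg_ mg gg gc.
have c1 : sq_integrable (cst c : R -> R).
  by apply: (@bounded_sq_integrable _ _ `|c|) => // t _.
apply: (@cvg_Rintegral _ (fun n t => x t * g_ n t) _ (fun t => `|x t * c|)).
- by move=> n; apply: measurable_funM => //; case: sx.
- by apply: measurable_funM => //; case: sx.
- by apply: aeW => t Dt; apply: cvgM; [exact: cvg_cst|exact: gg].
- apply: (@integrable_norm _ _ _ mu D (fun t => x t * c)).
  exact: sq_integrableM sx c1.
- move=> n t Dt; rewrite !normrM ler_wpM2l// (le_trans (gc n _ Dt))//.
  exact: ler_norm.
Qed.

Lemma measurable_flat e u k q : 0 < e -> measurable_fun D (flat e u k q).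
Proof.
move=> e0; apply: measurable_funTS; apply: continuous_measurable_fun => t.
apply/differentiable_continuous/derivable1_diffP.
by have [] := is_derive_flat u k q t e0.
Qed.

(** Taking [u * q] instead of [q] leaves only the first power of [e / u] in the derivative, which
    the exponential dominates uniformly in [e]. *)
Lemma flat_test_derive e u q t : 0 < e ->
  (flat e u 0 (u * q))^`()%classic t =
  if 0 < u.[t] then
    (u.[t] * q^`().[t] + u^`().[t] * q.[t] * (1 + e / u.[t])) *
    expR (- (e / u.[t])) else 0.
Proof.
move=> e0; rewrite derive1_flat// /flat; case: ifPn => // ut.
have u0 : u.[t] != 0 by rewrite gt_eqF.
rewrite derivM !(hornerD, hornerM, hornerN, hornerZ, horner_exp).
by move: (expR _) => E; field.
Qed.

(** The function [v q] lacks compact support in []0, 1[]. It is the limit of test functions [phi n],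
    equal to [u_n q exp (- e_n / u_n)] where [u_n = v - e_n] is positive and to 0 elsewhere; they
    and their derivatives converge pointwise and stay bounded, so both integrals pass to the
    limit. *)
Lemma weak_derivative_bubble x y q : L2 x -> is_weak_derivative x y ->
  ip x (horner (bubble * q)^`()) = - ip y (horner (bubble * q)).
Proof.
move=> /L2P sx [/L2P sy xy].
pose e n : R := n.+1%:R^-1; have e0 n : 0 < e n by rewrite invr_gt0.
have ecvg : e n @[n --> \oo] --> 0 by exact: cvg_harmonic.
have e1 n : e n <= 1 by rewrite invf_le1 ?ler1n.
pose u n : {poly R} := bubble - (e n)%:P.
have uE n t : (u n).[t] = t * (1 - t) - e n.
  by rewrite /u hornerD hornerN hornerC horner_bubble.
have duE n : (u n)^`() = bubble^`() by rewrite /u derivB derivC subr0.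
pose phi n := flat (e n) (u n) 0 (u n * q).
have phi_test n : test_function (phi n).
  apply: flat_test_function => // t; rewrite uE => h; have := e0 n => h'.
  apply/andP; split; rewrite ltNge; apply/negP => h1; nra.
have vpos t : D t -> 0 < t * (1 - t).
  by rewrite /= in_itv /= => /andP[t0 t1]; rewrite mulr_gt0// subr_gt0.
have ucvg t : (u n).[t] @[n --> \oo] --> t * (1 - t).
  under eq_fun do rewrite uE.
  apply: (cvg_lim_eq _ (subr0 _)); apply: cvgB => //; exact: cvg_cst.
have upos t : D t -> \forall n \near \oo, 0 < (u n).[t].
  by move=> /vpos vt; have /cvgr_gt/(_ 0 vt) := ucvg t.
have eucvg t : D t -> e n / (u n).[t] @[n --> \oo] --> 0.
  move=> Dt; apply: (cvg_lim_eq _ (mul0r (t * (1 - t))^-1)); apply: cvgM => //.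
  by apply: cvgV => //; rewrite gt_eqF// vpos.
have expcvg t : D t -> expR (- (e n / (u n).[t])) @[n --> \oo] --> (1 : R).
  move=> Dt; apply: (cvg_lim_eq _ (@expR0 R)).
  apply: (@continuous_cvg _ _ _ _ _ _ expR); first exact: continuous_expR.
  by apply: (cvg_lim_eq _ (@oppr0 R)); apply: cvgN; exact: eucvg.
have u1 n t : D t -> 0 < (u n).[t] -> (u n).[t] <= 1.
  move=> /unit_itv_bounds /andP[t0 t1] _; rewrite uE; have := e0 n; nra.
pose K p := \sum_(i < size p) `|p`_i|.
have KP p t : D t -> `|p.[t]| <= K p by move=> /unit_itv_bounds; exact: horner_le_coef.
have K0 p : 0 <= K p by apply: sumr_ge0.
have L1 : ip y (phi n) @[n --> \oo] --> ip y (horner (bubble * q)).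
  apply: (@cvg_ip _ _ _ (K q)) => //.
  - by move=> n; exact: measurable_flat.
  - exact: measurable_horner.
  - move=> t Dt; rewrite hornerM horner_bubble; apply: (cvg_lim_eq _ (mulr1 _)).
    apply: (@cvg_trans _
      ((u n).[t] * q.[t] * expR (- (e n / (u n).[t])) @[n --> \oo])).
      apply: near_eq_cvg; near=> n.
      have un : 0 < (u n).[t] by near: n; exact: upos.
      by rewrite /phi /flat un expr0 divr1 hornerM.
    apply: cvgM; last exact: expcvg.
    by apply: cvgM => //; exact: cvg_cst.
  - move=> n t Dt; rewrite /phi /flat; case: ifPn => [un|_]; last first.
      by rewrite normr0.
    rewrite expr0 divr1 hornerM !normrM (gtr0_norm un) (gtr0_norm (expR_gt0 _)).
    have E1 : expR (- (e n / (u n).[t])) <= 1.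
      by rewrite -expR0 ler_expR oppr_le0 divr_ge0// ltW.
    rewrite -[leRHS]mulr1; apply: ler_pM => //; rewrite ?expR_ge0//.
      by rewrite mulr_ge0// ltW.
    by rewrite -[leRHS]mul1r; apply: ler_pM => //;
      [exact: ltW|exact: u1|exact: KP].
have L2' : ip x (phi n)^`()%classic @[n --> \oo] -->
    ip x (horner (bubble * q)^`()).
  apply: (@cvg_ip _ _ _ (K q^`() + K (bubble^`() * q))) => //.
  - by move=> n; rewrite derive1_flat//; exact: measurable_flat.
  - exact: measurable_horner.
  - move=> t Dt; rewrite derivM hornerD !hornerM horner_bubble.
    apply: (@cvg_lim_eq _ _ ((t * (1 - t) * q^`().[t] +
      bubble^`().[t] * q.[t] * (1 + 0)) * 1)); last by ring.
    apply: (@cvg_trans _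
      (((u n).[t] * q^`().[t] + bubble^`().[t] * q.[t] * (1 + e n / (u n).[t]))
       * expR (- (e n / (u n).[t])) @[n --> \oo])).
      apply: near_eq_cvg; near=> n.
      have un : 0 < (u n).[t] by near: n; exact: upos.
      by rewrite flat_test_derive// un duE.
    apply: cvgM; last exact: expcvg.
    apply: cvgD; first by apply: cvgM => //; exact: cvg_cst.
    apply: cvgM; first exact: cvg_cst.
    by apply: cvgD; [exact: cvg_cst|exact: eucvg].
  - move=> n t Dt; rewrite flat_test_derive//; case: ifPn => [un|_]; last first.
      by rewrite normr0 addr_ge0.
    set s := e n / _; have s0 : 0 <= s by rewrite divr_ge0// ltW.
    (* From [1 + s <= exp s]: this bound, uniform in [n], controls the singular term [e n / u n]. *)
    have E1 : expR (- s) * (1 + s) <= 1.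
      by rewrite expRN mulrC ler_pdivrMr ?expR_gt0// mul1r expR_ge1Dx.
    have E2 : expR (- s) <= 1 by rewrite -expR0 ler_expR oppr_le0.
    have E3 := expR_ge0 (- s).
    have B1 := KP q^`() t Dt; have B2 := KP (bubble^`() * q) t Dt.
    rewrite duE -[bubble^`().[t] * q.[t]]hornerM mulrDl.
    rewrite (le_trans (ler_normD _ _))// lerD//.
      rewrite !normrM (gtr0_norm un) (ger0_norm E3).
      rewrite -[leRHS]mulr1; apply: ler_pM;
        [by rewrite mulr_ge0// ltW|exact: E3| |exact: E2].
      rewrite -[leRHS]mul1r.
      by apply: ler_pM; [exact: ltW|exact: normr_ge0|exact: u1|exact: B1].
    have E4 : 0 <= expR (- s) * (1 + s) by rewrite mulr_ge0// addr_ge0.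
    rewrite -mulrA normrM [(1 + s) * _]mulrC (ger0_norm E4).
    by rewrite -[leRHS]mulr1; apply: ler_pM.
have phiE n : ip x (phi n)^`()%classic = - ip y (phi n) by exact: xy.
have L3 : ip x (phi n)^`()%classic @[n --> \oo] -->
    - ip y (horner (bubble * q)).
  apply: (@cvg_trans _ (- ip y (phi n) @[n --> \oo])); last exact: cvgN.
  by apply: near_eq_cvg; apply: nearW => n; rewrite phiE.
exact: cvg_unique L2' L3.
Unshelve. all: by end_near. Qed.

End WeakDerivative.

(** * Density of polynomials *)

Section Density.
Context {R : realType}.
Local Notation mu := (@lebesgue_measure R).
Local Notation D := (`]0%R, 1%R[%classic : set R).
Implicit Types (p q : {poly R}) (f g h : R -> R).

Local Notation dist2 f g := (ip (fun t => f t - g t) (fun t => f t - g t)).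

Definition poly_approximable f := sq_integrable f /\
  forall e, 0 < e -> exists p, dist2 f (horner p) <= e.

Lemma poly_approximable_horner p : poly_approximable (horner p).
Proof.
split; first exact: sq_integrable_horner.
move=> e e0; exists p; rewrite /ip; under eq_Rintegral do rewrite subrr mul0r.
by rewrite Rintegral_cst ?mul0r ?ltW//; exact: measurable_unit_itv.
Qed.

Lemma poly_approximable_dense f : sq_integrable f ->
  (forall e, 0 < e -> exists2 g, poly_approximable g & dist2 f g <= e) ->
  poly_approximable f.
Proof.
move=> sf H; split => // e e0.
(* Distances are squared, so [ip_sqrD_le] replaces the triangle inequality and
   [2 (e/4) + 2 (e/4) = e]. *)
have e4 : 0 < e / 4 by rewrite divr_gt0.
have [g [sg gp] fg] := H _ e4; have [p gp'] := gp _ e4; exists p.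
have sp := sq_integrable_horner p.
have := ip_sqrD_le (sq_integrableB sf sg) (sq_integrableB sg sp).
under [X in ip X _]eq_fun do rewrite addrA subrK.
under [X in ip _ X]eq_fun do rewrite addrA subrK.
by move=> /le_trans; apply; lra.
Qed.

Lemma poly_approximableD f g : poly_approximable f -> poly_approximable g ->
  poly_approximable (fun t => f t + g t).
Proof.
move=> [sf fp] [sg gp]; split; first exact: sq_integrableD.
move=> e e0; have e4 : 0 < e / 4 by rewrite divr_gt0.
have [p fp'] := fp _ e4; have [q gq'] := gp _ e4; exists (p + q).
have := ip_sqrD_le (sq_integrableB sf (sq_integrable_horner p))
  (sq_integrableB sg (sq_integrable_horner q)).
have -> : (fun t => f t - p.[t] + (g t - q.[t])) =
    (fun t => f t + g t - (p + q).[t]).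
  by apply/funext => t; rewrite hornerD; ring.
by move=> /le_trans; apply; lra.
Qed.

Lemma poly_approximableZ (c : R) f : poly_approximable f ->
  poly_approximable (fun t => c * f t).
Proof.
move=> [sf fp]; split; first exact: sq_integrableZ.
move=> e e0; have c1 : 0 < c ^+ 2 + 1 by rewrite ltr_wpDl ?sqr_ge0.
have [p fp'] := fp _ (divr_gt0 e0 c1); exists (c *: p).
have sfp := sq_integrableB sf (sq_integrable_horner p).
have -> : (fun t => c * f t - (c *: p).[t]) = (fun t => c * (f t - p.[t])).
  by apply/funext => t; rewrite hornerZ mulrBr.
rewrite ipZr ?(ipC (fun t => c * _)) ?ipZr//; last exact: sq_integrableZ.
rewrite ler_pdivlMr// in fp'; have := ip_ge0 (fun t => f t - p.[t]); nra.
Qed.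

Lemma poly_approximable_sum n (F : 'I_n -> R -> R) :
  (forall i, poly_approximable (F i)) ->
  poly_approximable (fun t => \sum_(i < n) F i t).
Proof.
elim: n F => [|n IH] F Fp.
  have := poly_approximable_horner 0.
  by congr poly_approximable; apply/funext => t; rewrite big_ord0 horner0.
under eq_fun do rewrite big_ord_recl.
by apply: poly_approximableD => //; apply: IH.
Qed.

Lemma poly_approximable_cvg (g_ : nat -> R -> R) f h : sq_integrable f ->
  (forall n, poly_approximable (g_ n)) ->
  {ae mu, forall t, D t -> g_ n t @[n --> \oo] --> f t} ->
  mu.-integrable D (EFin \o h) ->
  (forall n t, D t -> (f t - g_ n t) ^+ 2 <= h t) ->
  poly_approximable f.
Proof.
move=> sf gp gf ih fgh; apply: poly_approximable_dense => // e e0.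
have L : dist2 f (g_ n) @[n --> \oo] --> \int[mu]_(t in D) (cst 0 t : R).
  apply: (@cvg_Rintegral _ _ _ h) => //.
  - move=> n; case: (gp n) => -[mg _] _; case: sf => mf _.
    exact: (measurable_funM (measurable_funB mf mg) (measurable_funB mf mg)).
  - apply: (@filterS _ _ (ae_filter_ringOfSetsType mu)) gf => t gft Dt /=.
    have L0 : f t - g_ n t @[n --> \oo] --> f t - f t.
      by apply: cvgB; [exact: cvg_cst|exact: gft].
    by apply: (cvg_lim_eq (cvgM L0 L0)); rewrite subrr mul0r.
  - by move=> n t Dt; rewrite -expr2 ger0_norm ?sqr_ge0// fgh.
move: L; rewrite Rintegral_cst ?mul0r; last exact: measurable_unit_itv.
move=> /cvgr_le /(_ _ e0) [N _ /(_ N (leqnn N)) ?].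
by exists (g_ N).
Qed.

(** * Polynomials converging to step functions *)

Lemma bernoulli_lower (x : R) n : 0 <= x <= 1 -> 1 - n%:R * x <= (1 - x) ^+ n.
Proof.
move=> /andP[x0 x1]; elim: n => [|n IH]; first by rewrite mul0r subr0 expr0.
have xp : 0 <= (1 - x) ^+ n by rewrite exprn_ge0 ?subr_ge0.
have := ler0n R n; rewrite exprS -natr1; nra.
Qed.

(** The product starts at 1 and does not increase with [n], as
    [(1 - x) (1 + (n+1) x) <= 1 + n x]. *)
Lemma bernoulli_upper (x : R) n : 0 <= x <= 1 ->
  (1 - x) ^+ n * (1 + n%:R * x) <= 1.
Proof.
move=> /andP[x0 x1]; elim: n => [|n IH]; first by rewrite mul0r addr0 mulr1.
apply: le_trans IH; rewrite exprS mulrAC [leRHS]mulrC.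
apply: ler_wpM2r; first by rewrite exprn_ge0 ?subr_ge0.
have := ler0n R n; rewrite -natr1; nra.
Qed.

(* Whether [2 ^ n * s ^ n] tends to [0] or to [+oo] decides the limit. *)
Lemma step_cvg (s : R) : 0 <= s <= 1 -> s != 2^-1 ->
  (1 - s ^+ n) ^+ (2 ^ n) @[n --> \oo] --> ((if s < 2^-1 then 1 else 0) : R).
Proof.
move=> /andP[s0 s1] s2.
have sn n : 0 <= s ^+ n <= 1 by rewrite exprn_ge0// exprn_ile1.
have pn n : 0 <= (1 - s ^+ n) ^+ (2 ^ n) <= 1.
  have /andP[? ?] := sn n.
  by rewrite exprn_ge0 ?subr_ge0//= exprn_ile1 ?subr_ge0// gerBl.
have En n : (2 ^ n)%:R * s ^+ n = (2 * s) ^+ n :> R by rewrite natrX exprMn.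
have [ls|ge] := ltP s 2^-1.
  have L : 1 - (2 * s) ^+ n @[n --> \oo] --> (1 - 0 : R).
    apply: cvgB; first exact: cvg_cst.
    by apply: cvg_expr; rewrite ger0_norm ?mulr_ge0//; lra.
  rewrite subr0 in L.
  have H : \forall n \near \oo,
      1 - (2 * s) ^+ n <= (1 - s ^+ n) ^+ (2 ^ n) <= cst 1 n.
    apply: nearW => n; have /andP[_ ->] := pn n.
    by rewrite andbT -En bernoulli_lower.
  exact: squeeze_cvgr H _ L (cvg_cst _).
have gs : 2^-1 < s by rewrite lt_neqAle eq_sym s2.
have s20 : 0 < 2 * s by lra.
have L : ((2 * s)^-1) ^+ n @[n --> \oo] --> (0 : R).
  by apply: cvg_expr; rewrite ger0_norm ?invr_ge0 ?ltW// invf_lt1//; lra.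
have H : \forall n \near \oo,
    cst 0 n <= (1 - s ^+ n) ^+ (2 ^ n) <= ((2 * s)^-1) ^+ n; last first.
  exact: squeeze_cvgr H _ (cvg_cst _) L.
apply: nearW => n; have /andP[-> _] /= := pn n.
have := bernoulli_upper (2 ^ n) (sn n); rewrite En.
have an : 0 < (2 * s) ^+ n by rewrite exprn_gt0.
rewrite exprVn -ler_pdivlMr ?ltr_pwDl//; last by rewrite ltW.
move=> /le_trans; apply; rewrite mul1r lef_pV2 ?posrE ?lerDr//.
by rewrite ltr_pwDl// ltW.
Qed.

(** An increasing affine [S] with [S(a) = 1/2] moves the jump to 1/2, where the polynomials
    [(1 - s^n)^(2^n)] of the elementary proof of the Stone-Weierstrass theorem separate the two
    sides. *)
Lemma poly_approximable_ray (a : R) : poly_approximable \1_`]-oo, a[.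
Proof.
(* [K] bounds [|t - a|] on []0, 1[], so the slope [1 / (2 K)] keeps [S] within [[0, 1]]. *)
pose K := 1 + `|a|; have K0 : 0 < K by rewrite ltr_pwDl.
pose S : {poly R} := 2^-1%:P + (2 * K)^-1 *: ('X - a%:P).
have SE t : S.[t] = 2^-1 + (2 * K)^-1 * (t - a).
  by rewrite /S hornerD hornerC hornerZ hornerXsubC.
have K20 : 0 < (2 * K)^-1 by rewrite invr_gt0 mulr_gt0.
have Slt t : (S.[t] < 2^-1) = (t < a).
  by rewrite SE gtrDl pmulr_rlt0// subr_lt0.
have Seq t : (S.[t] == 2^-1) = (t == a).
  by rewrite SE -subr_eq0 addrC addKr mulf_eq0 gt_eqF//= subr_eq0.
have S01 t : D t -> 0 <= S.[t] <= 1.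
  move=> /unit_itv_bounds /andP[t0 t1].
  have ta : `|t - a| <= K.
    by rewrite (le_trans (ler_normB _ _))// lerD2r ger0_norm.
  have : `|(2 * K)^-1 * (t - a)| <= 2^-1.
    rewrite normrM gtr0_norm// invfM -mulrA ler_piMr// mulrC ler_pdivrMr//.
    by rewrite mul1r.
  by rewrite SE ler_norml => /andP[? ?]; apply/andP; split; lra.
pose Q n : {poly R} := (1 - S ^+ n) ^+ (2 ^ n).
have QE n t : (Q n).[t] = (1 - S.[t] ^+ n) ^+ (2 ^ n).
  by rewrite /Q horner_exp hornerD hornerN hornerC horner_exp.
have mI : measurable (`]-oo, a[%classic : set R) by exact: measurable_itv.
have IE t : \1_`]-oo, a[ t = (if t < a then 1 else 0) :> R.
  by rewrite indicE (_ : (t \in _) = (t < a)) ?(fun_if (fun b : bool => b%:R))//;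
    [case: ifP|apply/idP/idP; rewrite inE /= in_itv].
apply: (@poly_approximable_cvg (fun n => horner (Q n)) _ (cst 1)).
- apply: (@bounded_sq_integrable _ _ 1); first exact: measurable_indic.
  by move=> t _; rewrite IE; case: ifP; rewrite ?normr0 ?normr1.
- by move=> n; exact: poly_approximable_horner.
(* At [t = a] the values tend to [1/e], neither 0 nor 1: convergence holds off this null set
   only. *)
- exists [set a]; split => //; first exact: lebesgue_measure_set1.
  move=> t /= /not_implyP[Dt H]; apply: contrapT => ta; apply: H.
  under eq_fun do rewrite QE.
  rewrite IE -Slt; apply: step_cvg; first exact: S01.
  by rewrite Seq; apply/eqP.
- by apply: (@bounded_integrable _ _ 1) => // t _; rewrite normr1.
- move=> n t Dt; rewrite IE QE /=; have /andP[s0 s1] := S01 t Dt.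
  have [q0 q1] : 0 <= (1 - S.[t] ^+ n) /\ (1 - S.[t] ^+ n) <= 1.
    by rewrite subr_ge0 exprn_ile1// gerBl exprn_ge0.
  have := exprn_ge0 (2 ^ n) q0; have := exprn_ile1 (2 ^ n) q0 q1.
  by case: (t < a); rewrite /=; nra.
Qed.

(** * From rays to Borel sets, simple functions and all of L^2 *)

Lemma sum_indic_trivIset (F : (set R)^nat) n i t : trivIset setT F -> F i t ->
  \sum_(k < n) \1_(F k) t = (i < n)%N%:R :> R.
Proof.
move=> /trivIsetP tF Fit.
have F0 k : k != i -> \1_(F k) t = 0 :> R.
  move=> ki; rewrite indicE memNset// => Fkt.
  by have /seteqP[+ _] := tF k i Logic.I Logic.I ki => /(_ t); apply.
have [ltin|nlei] := ltnP i n.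
  rewrite (bigD1 (Ordinal ltin))//= big1 ?addr0 ?indicE ?mem_set//.
  by move=> k; rewrite -val_eqE /=; exact: F0.
by rewrite big1// => k _; rewrite F0// ltn_eqF// (leq_trans (ltn_ord k)).
Qed.

(** Rays are stable under intersection and generate the Borel sets, and the sets with approximable
    indicator form a Dynkin class; disjoint unions follow by dominated convergence of the partial
    sums. *)
Lemma poly_approximable_indic (A : set R) : measurable A ->
  poly_approximable \1_A.
Proof.
have sq1 (B : set R) : measurable B -> sq_integrable (\1_B : R -> R).
  move=> mB; apply: (@bounded_sq_integrable _ _ 1).
    exact: measurable_indic.
  by move=> t _; rewrite indicE normr_nat; case: (_ \in _).
move=> mA.
apply: (@dynkin_induction _ (measurableTypeR R) (@RGenInftyO.G R)
  (fun B => poly_approximable \1_B)).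
- exact: RGenInftyO.measurableE.
- move=> B C [b ->] [c ->]; exists (Num.min b c).
  apply/seteqP; split => t /=; rewrite !in_itv /= lt_min.
    by move=> [-> ->].
  by move=> /andP[].
- have := poly_approximable_horner 1.
  by congr poly_approximable; apply/funext => t; rewrite indicT hornerC.
- by move=> B [b ->]; exact: poly_approximable_ray.
- move=> B mB pB.
  have := poly_approximableD (poly_approximable_horner 1)
    (poly_approximableZ (-1) pB).
  congr poly_approximable; apply/funext => t.
  rewrite hornerC indicC indicE; case: (_ \in _) => /=; ring.
- move=> F mF tF pF.
  apply: (@poly_approximable_cvg (fun n t => \sum_(i < n) \1_(F i) t) _ (cst 1)).
  + apply: sq1; apply: bigcup_measurable => k _; exact: mF.
  + by move=> n; apply: poly_approximable_sum.
  + apply: aeW => t Dt; have [[i _ Fit]|NFt] := pselect ((\bigcup_k F k) t).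
      rewrite indicE mem_set; last by exists i.
      apply: cvg_near_cst; exists i.+1 => // n /= lein.
      by rewrite (sum_indic_trivIset _ tF Fit) lein.
    rewrite indicE memNset//; apply: cvg_near_cst; apply: nearW => n.
    by rewrite big1// => k _; rewrite indicE memNset// => Fkt; apply: NFt; exists k.
  + by apply: (@bounded_integrable _ _ 1) => // t _; rewrite normr1.
  + move=> n t Dt; have [[i _ Fit]|NFt] := pselect ((\bigcup_k F k) t).
      rewrite indicE mem_set ?(sum_indic_trivIset _ tF Fit); last by exists i.
      by case: (_ < _)%N; rewrite /=; lra.
    rewrite indicE memNset// big1; first by rewrite subrr expr0n.
    by move=> k _; rewrite indicE memNset// => Fkt; apply: NFt; exists k.
- by rewrite -[X in X A](RGenInftyO.measurableE R).
Qed.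

Import HBNNSimple.

Lemma poly_approximable_ge0 f : (forall t, 0 <= f t) -> sq_integrable f ->
  poly_approximable f.
Proof.
move=> f0 sf; have [mf f2] := sf.
have mf' : measurable_fun D (EFin \o f) by exact/measurable_EFinP.
pose g := nnsfun_approx (@measurable_unit_itv R) mf'.
have gf n t : D t -> 0 <= g n t <= f t.
  move=> Dt; rewrite fun_ge0 /= -lee_fin /g nnsfun_approxE.
  by apply: le_approx => // x _; rewrite /= lee_fin.
apply: (@poly_approximable_cvg (fun n => g n) _ (fun t => f t ^+ 2)) => //.
- move=> n; rewrite (funext (fimfunEord (g n))).
  apply: poly_approximable_sum => i; apply: poly_approximableZ.
  by apply: poly_approximable_indic; exact: measurable_funPTI.
- apply: aeW => t Dt.
  have /fine_cvgP[_] // : EFin \o g ^~ t @ \oo --> (f t)%:E.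
  apply: (@cvg_nnsfun_approx _ _ _ _ (@measurable_unit_itv R) _ mf') => // x _.
  by rewrite /= lee_fin.
- move=> n t Dt; have /andP[? ?] := gf n t Dt; nra.
Qed.

Theorem poly_dense f : sq_integrable f -> poly_approximable f.
Proof.
move=> sf; have [mf f2] := sf.
have sge0 g : measurable_fun D g -> (forall t, `|g t| <= `|f t|) ->
    sq_integrable g.
  move=> mg gf; split => //.
  apply: (@le_integrable _ _ _ mu D (@measurable_unit_itv R) _
    (EFin \o (fun t => f t ^+ 2))) => //.
    by apply/measurable_EFinP; exact: measurable_funX.
  by move=> t _; rewrite /= lee_fin !normrX lerXn2r ?nnegrE.
have pp : poly_approximable (f^\+).
  apply: poly_approximable_ge0; first exact: funrpos_ge0.
  apply: sge0; first exact: measurable_funrpos.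
  move=> t; rewrite ger0_norm ?funrpos_ge0// /funrpos ge_max normr_ge0.
  by rewrite ler_norm.
have pn : poly_approximable (f^\-).
  apply: poly_approximable_ge0; first exact: funrneg_ge0.
  apply: sge0; first exact: measurable_funrneg.
  move=> t; rewrite ger0_norm ?funrneg_ge0// /funrneg ge_max normr_ge0.
  by rewrite -normrN ler_norm.
have := poly_approximableD pp (poly_approximableZ (-1) pn).
congr poly_approximable; apply/funext => t.
by rewrite mulN1r -[in RHS](funrposBneg f).
Qed.

End Density.

(** * Stability in terms of the Legendre expansion *)

Section Stability.
Context {R : realType}.
Local Notation mu := (@lebesgue_measure R).
Local Notation D := (`]0%R, 1%R[%classic : set R).
Implicit Types (p q : {poly R}) (x y : R -> R) (s : seq nat).

Lemma ip_horner_sum x s (c : nat -> R) (P : nat -> {poly R}) :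
  sq_integrable x ->
  ip x (horner (\sum_(k <- s) c k *: P k)) =
  \sum_(k <- s) c k * ip x (horner (P k)).
Proof.
move=> sx; elim: s => [|k s IH].
  rewrite !big_nil /ip -[RHS](mul0r (fine (mu D))).
  rewrite -(Rintegral_cst mu (@measurable_unit_itv R)).
  by apply: eq_Rintegral => t _; rewrite horner0 mulr0.
have sp q : sq_integrable (horner q) by exact: sq_integrable_horner.
have sZ := sq_integrableZ (c k) (sp (P k)).
rewrite !big_cons -IH -ipZr// -(ipDr sx sZ (sp _)).
by congr ip; apply/funext => t; rewrite hornerD hornerZ.
Qed.

Lemma pint_legendre_mul j k : pint (legendre j * legendre k : {poly R}) =
  if j == k then (2 * k + 1)%:R^-1 else 0.
Proof.
by case: eqVneq => [->|]; [rewrite -expr2 legendre_sqr|exact: legendre_ortho].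
Qed.

Lemma pint_legendre_sum s (c : nat -> R) k : uniq s -> k \in s ->
  pint ((\sum_(j <- s) c j *: legendre j) * legendre k) = c k / (2 * k + 1)%:R.
Proof.
move=> us ks; rewrite mulr_suml pint_sum (bigD1_seq k)//= big1.
  by rewrite addr0 -scalerAl pintZ pint_legendre_mul eqxx.
by move=> j jk; rewrite -scalerAl pintZ pint_legendre_mul (negPf jk) mulr0.
Qed.

Lemma pint_legendre_sum2 s (b c : nat -> R) : uniq s ->
  pint ((\sum_(j <- s) b j *: legendre j) * (\sum_(k <- s) c k *: legendre k)) =
  \sum_(k <- s) b k * c k / (2 * k + 1)%:R.
Proof.
move=> us; rewrite mulr_sumr pint_sum big_seq [RHS]big_seq.
apply: eq_bigr => k ks.
by rewrite -scalerAr pintZ pint_legendre_sum// mulrA [c k * _]mulrC.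
Qed.

Definition legendre_coef x k : R := ip x (horner (legendre k)).

(** Expanding [p] with coefficients [b_k] and completing the square in each, the gap between the two
    sides is the sum of [(w a - b_k)^2 / w], with [w = 2k+1] and [a] the coefficient of [x]. *)
Lemma bessel_converse x p n : sq_integrable x -> (size p <= n)%N ->
  ip x x <= \sum_(0 <= k < n) (2 * k + 1)%:R * legendre_coef x k ^+ 2 +
    ip (fun t => x t - p.[t]) (fun t => x t - p.[t]).
Proof.
move=> sx /legendre_span[b ->].
rewrite -(big_mkord xpredT (fun k => b k *: legendre k)).
have sp q : sq_integrable (horner q) by exact: sq_integrable_horner.
rewrite ip_sqrB// ip_horner_sum// ip_horner pint_legendre_sum2 ?iota_uniq//.
set A := \sum_(_ <= _ < _) _; set B := \sum_(_ <- _) _; set C := \sum_(_ <- _) _.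
suff : 0 <= A - 2 * B + C by lra.
rewrite /A /B /C mulr_sumr -sumrB -big_split /=.
apply: sumr_ge0 => k _; rewrite -/(legendre_coef x k).
have w0 : (2 * k + 1)%:R != 0 :> R by rewrite pnatr_eq0 addn1.
move: (legendre_coef x k) (b k) => a c.
have -> : (2 * k + 1)%:R * a ^+ 2 - 2 * (c * a) + c * c / (2 * k + 1)%:R =
    ((2 * k + 1)%:R * a - c) ^+ 2 / (2 * k + 1)%:R by field.
by rewrite divr_ge0 ?sqr_ge0.
Qed.

(** A duality argument: the tail [S] equals the product of [y] with [v g'], where [- (v g')'] is the
    part of the expansion of [x] between [n] and [m]. The norm of [v g'] is itself controlled by
    [S], so Cauchy-Schwarz gives [S^2 <= |y|^2 S / (4 n^2)], and one factor [S] cancels. *)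
Lemma legendre_tail x y n m : L2 x -> is_weak_derivative x y -> (0 < n)%N ->
  \sum_(n <= k < m) (2 * k + 1)%:R * legendre_coef x k ^+ 2 <=
  ip y y / (4 * n%:R ^+ 2).
Proof.
move=> Lx xy n0; have sx : sq_integrable x by exact/L2P.
have sy : sq_integrable y by case: xy => /L2P.
have sp q : sq_integrable (horner q) by exact: sq_integrable_horner.
set S := (X in X <= _).
pose a k := legendre_coef x k; pose w k : R := (2 * k + 1)%:R.
pose l k : R := (k * k.+1)%:R.
have w0 k : w k != 0 by rewrite pnatr_eq0 addn1.
have l0 k : (n <= k)%N -> 0 < l k.
  by move=> nk; rewrite ltr0n muln_gt0 (leq_trans n0 nk).
pose g : {poly R} := \sum_(k <- index_iota n m) (w k * a k / l k) *: legendre k.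
(* [- legendre_op g] is the part of the expansion of [x] between [n] and [m] *)
have lopg : legendre_op g =
    \sum_(k <- index_iota n m) (- (w k * a k)) *: legendre k.
  rewrite linear_sum /= big_seq [RHS]big_seq; apply: eq_bigr => k.
  rewrite mem_index_iota => /andP[nk _].
  rewrite linearZ /= legendre_eigen scalerA -/(l k); congr (_ *: _).
  by rewrite mulrN divfK// gt_eqF// l0.
have SE : S = ip y (horner (bubble * g^`())).
  have := weak_derivative_bubble g^`() Lx xy.
  rewrite -/(legendre_op g) lopg ip_horner_sum// => /eqP.
  rewrite -eqr_oppLR => /eqP <-; rewrite -sumrN; apply: eq_bigr => k _.
  by rewrite -/(legendre_coef x k) /a /w; ring.
have gg : pint (bubble * g^`() * g^`()) =
    \sum_(k <- index_iota n m) w k * a k ^+ 2 / l k.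
  rewrite -[LHS]opprK -pint_legendre_op lopg /g pint_legendre_sum2 ?iota_uniq//.
  rewrite -sumrN big_seq [RHS]big_seq; apply: eq_bigr => k.
  rewrite mem_index_iota => /andP[nk _]; rewrite -/(w k).
  move: (w k) (l k) (a k) (w0 k) (l0 k nk) => W L A W0 L0.
  by field; rewrite W0 gt_eqF.
have n2 : 0 < n%:R ^+ 2 :> R by rewrite exprn_gt0// ltr0n.
have ggS : pint (bubble * g^`() * g^`()) <= S / n%:R ^+ 2.
  rewrite gg /S mulr_suml big_seq [leRHS]big_seq; apply: ler_sum => k.
  rewrite mem_index_iota => /andP[nk _]; rewrite -/(w k) -/(a k).
  apply: ler_wpM2l; first by rewrite mulr_ge0 ?sqr_ge0 ?ler0n.
  rewrite lef_pV2 ?posrE ?l0// -natrX ler_nat expnS expn1.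
  by rewrite leq_mul// (leq_trans nk).
have vg : ip (horner (bubble * g^`())) (horner (bubble * g^`())) <=
    S / (4 * n%:R ^+ 2).
  rewrite ip_horner; apply: (@le_trans _ _ (4^-1 * pint (bubble * g^`() * g^`()))).
    rewrite -subr_ge0 -pintZ -pintB; apply: pint_ge0 => t /andP[t0 t1].
    rewrite hornerD hornerN hornerZ !hornerM horner_bubble subr_ge0.
    have v0 : 0 <= t * (1 - t) by rewrite mulr_ge0// subr_ge0.
    have v4 : 0 <= 4^-1 - t * (1 - t).
      by have := sqr_ge0 (t - 2^-1); rewrite sqrrB; lra.
    have := mulr_ge0 (mulr_ge0 v0 (sqr_ge0 g^`().[t])) v4; lra.
  by rewrite invfM mulrCA ler_wpM2l ?invr_ge0.
have S0 : 0 <= S by apply: sumr_ge0 => k _; rewrite mulr_ge0 ?sqr_ge0.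
have := cauchy_schwarz sy (sp (bubble * g^`())); rewrite -SE => CS.
have {}CS : S ^+ 2 <= ip y y * (S / (4 * n%:R ^+ 2)).
  by apply: le_trans CS _; rewrite ler_wpM2l// ip_ge0.
move: S0; rewrite le_eqVlt => /predU1P[<-|S0].
  by rewrite divr_ge0 ?ip_ge0// mulr_ge0// ltW.
by rewrite -(ler_pM2l S0) -expr2 (le_trans CS)// mulrCA.
Qed.

Lemma legendre_coef_le x (d : R) k :
  L2 x -> (forall j, `|moment_op x j| <= d) ->
  `|legendre_coef x k| <= 8 ^+ k * d.
Proof.
move=> /L2P sx md; have d0 : 0 <= d := le_trans (normr_ge0 _) (md 0%N).
have -> : legendre_coef x k =
    \sum_(j < size (legendre k : {poly R})) (legendre k)`_j * moment_op x j.
  rewrite /legendre_coef -[legendre k in LHS]coefK poly_def.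
  rewrite -(big_mkord xpredT (fun j => (legendre k)`_j *: 'X^j)).
  rewrite ip_horner_sum// big_mkord; apply: eq_bigr => j _; congr (_ * _).
  by apply: eq_Rintegral => t _; rewrite hornerXn mulrC.
apply: le_trans (ler_norm_sum _ _ _) _.
apply: le_trans (ler_wpM2r d0 (legendre_coef_sum k)).
by rewrite mulr_suml; apply: ler_sum => j _; rewrite normrM ler_wpM2l.
Qed.

Lemma sum_odd n : \sum_(0 <= k < n) (2 * k + 1)%:R = n%:R ^+ 2 :> R.
Proof.
elim: n => [|n IH]; first by rewrite big_geq// expr0n.
by rewrite big_nat_recr//= IH natrD natrM -natr1; ring.
Qed.

Lemma legendre_head x (d : R) n : L2 x -> (forall j, `|moment_op x j| <= d) ->
  \sum_(0 <= k < n) (2 * k + 1)%:R * legendre_coef x k ^+ 2 <=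
  n%:R ^+ 2 * 64 ^+ n * d ^+ 2.
Proof.
move=> Lx md; have d0 : 0 <= d := le_trans (normr_ge0 _) (md 0%N).
rewrite -sum_odd -mulrA mulr_suml big_nat [leRHS]big_nat.
apply: ler_sum => k /andP[_ kn]; apply: ler_wpM2l => //.
rewrite -real_normK ?num_real//.
apply: (@le_trans _ _ ((8 ^+ k * d) ^+ 2)).
  by rewrite lerXn2r ?nnegrE ?mulr_ge0 ?exprn_ge0// legendre_coef_le.
rewrite exprMn ler_wpM2r ?sqr_ge0// -exprM mulnC exprM.
have -> : 8 ^+ 2 = 64 :> R by rewrite -natrX.
by rewrite ler_weXn2l ?ler1n// ltnW.
Qed.

(** The tail bound is uniform in its upper end [m], so the degree of the approximating polynomial
    may grow freely as the error [e] tends to 0 with [n] fixed. *)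
Lemma L2_stability x y (d : R) n : L2 x -> is_weak_derivative x y ->
  (forall j, `|moment_op x j| <= d) -> (0 < n)%N ->
  ip x x <= n%:R ^+ 2 * 64 ^+ n * d ^+ 2 + ip y y / (4 * n%:R ^+ 2).
Proof.
move=> Lx xy md n0; apply/ler_addgt0Pr => e e0.
have sx : sq_integrable x by exact/L2P.
have [_ /(_ _ e0)[p pe]] := poly_dense sx.
pose m := maxn (size p) n.
apply: le_trans (bessel_converse sx (leq_maxl (size p) n)) _.
rewrite (@big_cat_nat _ _ _ n)//=; last exact: leq_maxr.
by rewrite lerD// lerD//; [exact: legendre_head|exact: legendre_tail].
Qed.

End Stability.

(** * Choice of the degree *)

Section Numerics.
Context {R : realType}.

Lemma expR5_ge64 : 64 <= expR 5 :> R.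
Proof.
have -> : 5 = 20%:R * 4^-1 :> R by field.
(* The chain is [exp 5 >= (5/4)^20 >= (12/5)^5 >= 64]; rounding [(5/4)^4] down to [12/5] keeps the
   numbers small. *)
have h : 5 / 4 <= expR 4^-1 :> R.
  by apply: le_trans (expR_ge1Dx _); lra.
rewrite expRM_natl; apply: le_trans (_ : (5 / 4) ^+ 20 <= _); last first.
  by rewrite lerXn2r ?nnegrE ?expR_ge0//; lra.
have -> : (5 / 4) ^+ 20 = ((5 / 4) ^+ 4) ^+ 5 :> R by rewrite -exprM.
apply: (@le_trans _ _ ((12 / 5) ^+ 5)); first by rewrite !exprS expr0; lra.
by rewrite lerXn2r ?nnegrE ?exprn_ge0 ?divr_ge0// !exprS expr0; lra.
Qed.

(** Used with [z = L / 3], so that the right-hand side is [2 / L^2]. The threshold 60 comes from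
    [z^6 / 6! = 5 z^4 (z / 60)^2], and the final comparison is [1/5 <= 2/9]. *)
Lemma sqr_expRN_le (z : R) : 60 <= z ->
  z ^+ 2 * expR (- z) <= 2 * (3 * z) ^- 2.
Proof.
move=> z60; have z0 : 0 < z by lra.
have E1 : 5 * z ^+ 4 <= expR z.
  have := expR_ge1Dxn 5 (ltW z0); apply: le_trans; apply: ler_wpDl => //.
  have -> : z ^+ 6 / 6`!%:R = 5 * z ^+ 4 * (z / 60) ^+ 2.
    by rewrite -[6`!]/(10 * (8 * 9))%N !natrM; field.
  rewrite ler_peMr ?exprn_ege1//; first by rewrite mulr_ge0// exprn_ge0// ltW.
  by lra.
have E2 : expR (- z) <= (5 * z ^+ 4)^-1.
  by rewrite expRN lef_pV2 ?posrE ?expR_gt0// mulr_gt0// exprn_gt0.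
apply: (@le_trans _ _ (z ^+ 2 * (5 * z ^+ 4)^-1)).
  by rewrite ler_wpM2l ?sqr_ge0.
have -> : z ^+ 2 / (5 * z ^+ 4) = 5^-1 * z ^- 2 by field; rewrite gt_eqF.
have -> : 2 * (3 * z) ^- 2 = 2 / 9 * z ^- 2 by field; rewrite gt_eqF.
by rewrite ler_wpM2r ?invr_ge0 ?sqr_ge0//; lra.
Qed.

(* The choice [n ~ L / 3] makes the first term exponentially small, since
   [ln 64 / 3 < 2], and the second one at most [4 / L ^ 2]. *)
Lemma degree_balance (L : R) : 180 <= L -> exists2 n, (0 < n)%N &
  n%:R ^+ 2 * 64 ^+ n * expR (- L) ^+ 2 + (4 * n%:R ^+ 2)^-1 <=
  49 / 8 * L ^- 2.
Proof.
move=> L180; have L0 : 0 < L by lra.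
have L3 : 0 <= L / 3 by lra.
have /andP[n1 n2] := truncn_itv L3; set n := Num.truncn _ in n1 n2.
rewrite -[n.+1%:R]natr1 in n2.
(* Since [n > L / 3 - 1], this holds as soon as [L >= 12]. *)
have nL : L / 4 <= n%:R by lra.
have n0 : 0 < n%:R :> R by lra.
exists n; first by rewrite -(ltr0n R).
have E1 : 64 ^+ n <= expR (5 / 3 * L).
  apply: (@le_trans _ _ (expR 5 ^+ n)).
    by rewrite lerXn2r ?nnegrE ?expR_ge0// expR5_ge64.
  rewrite -expRM_natl ler_expR; lra.
have E2 : 64 ^+ n * expR (- L) ^+ 2 <= expR (- (L / 3)).
  rewrite -expRM_natl; have -> : - (L / 3) = 5 / 3 * L + 2%:R * - L by field.
  by rewrite expRD ler_wpM2r ?expR_ge0.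
have T1 : n%:R ^+ 2 * 64 ^+ n * expR (- L) ^+ 2 <= 2 * L ^- 2.
  have zL : 60 <= L / 3 by lra.
  have -> : 2 * L ^- 2 = 2 * (3 * (L / 3)) ^- 2.
    by congr (_ * _ ^- 2); field.
  apply: le_trans (sqr_expRN_le zL); rewrite -mulrA.
  apply: ler_pM; rewrite ?sqr_ge0 ?mulr_ge0 ?exprn_ge0 ?sqr_ge0//.
  by rewrite lerXn2r ?nnegrE ?ler0n.
have T2 : (4 * n%:R ^+ 2)^-1 <= 4 * L ^- 2.
  have -> : 4 * L ^- 2 = (4 * (L / 4) ^+ 2)^-1 by field; rewrite gt_eqF.
  have L40 : 0 < L / 4 by lra.
  rewrite lef_pV2 ?posrE ?mulr_gt0 ?exprn_gt0// ler_wpM2l//.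
  by rewrite lerXn2r ?nnegrE ?ler0n// ltW.
have T3 : 0 < L ^- 2 by rewrite invr_gt0 exprn_gt0.
lra.
Qed.

(** The data enter the estimates only through this uniform bound on the moments: one term of a
    nonnegative series is at most its sum. *)
Lemma l2norm_ge (a : nat -> R) (d : R) j :
  (l2norm a <= d%:E)%E -> `|a j| <= d.
Proof.
rewrite /l2norm Lnorm_counting// => ad; rewrite -lee_fin; apply: le_trans ad.
have -> : (`|a j|%:E = (`|(EFin \o a) j| `^ 2) `^ 2^-1)%E.
  by rewrite -poweRrM divff ?pnatr_eq0// poweRe1.
apply: gt0_ler_poweR; rewrite ?invr_ge0//.
- by rewrite in_itv /= leey andbT ?lee_fin ?powR_ge0.
- by rewrite in_itv /= leey nneseries_ge0// => k _ _; exact: poweR_ge0.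
rewrite (@nneseriesD1 _ _ j)//; last by move=> k _; exact: poweR_ge0.
by rewrite leeDl// nneseries_ge0// => k _ _; exact: poweR_ge0.
Qed.

End Numerics.

(** * The logarithmic rate *)

(** Here [d] is any bound on the moments, which serves both the case where it is the norm of the
    data and the supremum, where it only dominates that norm. *)
Lemma log_stability (R : realType) (E d : R) (x : R -> R) :
  0 < E -> H1 x -> H1norm x <= E -> (forall j, `|moment_op x j| <= d) ->
  0 < d / E -> d / E <= expR (- 180) ->
  L2norm x <= 7 / Num.sqrt 8 * E * (- ln (d / E))^-1.
Proof.
move=> E0 [Lx xH] xE md r0 rc.
pose y := weak_derivative x.
have xy : is_weak_derivative x y by exact: xgetPex.
have Ly : L2 y by case: xy.
pose L := - ln (d / E).
have rE : d / E = expR (- L) by rewrite opprK lnK.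
have L180 : 180 <= L.
  by move: rc; rewrite rE ler_expR lerN2.
have L0 : 0 < L by lra.
have [n n0 nL] := degree_balance L180.
have yE : ip y y <= E ^+ 2.
  rewrite -L2norm_sqr//; apply: (@le_trans _ _ (H1norm x ^+ 2)).
    by rewrite sqr_sqrtr ?addr_ge0 ?sqr_ge0// lerDr sqr_ge0.
  by rewrite lerXn2r ?nnegrE ?sqrtr_ge0// ltW.
have dE : d = E * expR (- L) by rewrite -rE mulrC divfK// gt_eqF.
have n2 : 0 < 4 * n%:R ^+ 2 :> R by rewrite mulr_gt0// exprn_gt0// ltr0n.
have key : L2norm x ^+ 2 <= E ^+ 2 * (49 / 8 * L ^- 2).
  rewrite L2norm_sqr// (le_trans (L2_stability Lx xy md n0))//.
  apply: le_trans (ler_wpM2l (sqr_ge0 E) nL).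
  rewrite mulrDr lerD//; last by rewrite ler_wpM2r// invr_ge0 ltW.
  by rewrite dE exprMn mulrCA.
have B0 : 0 <= 7 / Num.sqrt 8 * E * L^-1.
  by rewrite !mulr_ge0 ?invr_ge0 ?sqrtr_ge0 ?(ltW E0) ?(ltW L0).
rewrite -(@ler_pXn2r _ 2)// ?nnegrE ?L2norm_ge0//.
apply: le_trans key _; rewrite !exprMn !exprVn sqr_sqrtr//.
rewrite -/L; move: L L0 {L180 rE nL dE B0} => L L0.
by rewrite le_eqVlt; apply/orP; left; apply/eqP; field; rewrite gt_eqF.
Qed.

Theorem theorem1 (R : realType) :
  (exists C c0 : R,
     0 < C /\ 0 < c0 /\
     forall (E : R) (x : R -> R) (delta : R),
       0 < E -> H1 x -> H1norm x <= E ->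
       l2norm (moment_op x) = delta%:E ->
       0 < delta / E -> delta / E <= c0 ->
       L2norm x <= 7 / Num.sqrt 8 * E * (- ln (C * (delta / E)))^-1)
  /\
  (fun delta : R =>
     sup [set L2norm x | x in
            [set x : R -> R | H1 x /\ H1norm x <= 1 /\
               (l2norm (moment_op x) <= delta%:E)%E]] : R^o)
    =O_ (0^'+) (fun delta : R => (ln (1 / delta))^-1 : R^o).
Proof.
split.
  (* The threshold means [L >= 180], that is [L / 3 >= 60]. *)
  exists 1, (expR (- 180)); split; first exact: ltr01.
  split=> [|E x d E0 xH xE xd d0 dc]; first exact: expR_gt0.
  rewrite mul1r; apply: log_stability => // j.
  by apply: l2norm_ge; rewrite xd.
apply/eqO_exP; exists (7 / Num.sqrt 8).
  by rewrite divr_gt0// sqrtr_gt0.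
near=> d.
have d0 : 0 < d by near: d; exact: nbhs_right_gt.
have dc : d <= expR (- 180) by near: d; apply: nbhs_right_le; exact: expR_gt0.
have ld : ln (1 / d) = - ln d by rewrite div1r lnV.
have ld0 : 0 < - ln d.
  by rewrite oppr_gt0 ln_lt0// d0 (le_lt_trans dc)// expR_lt1 oppr_lt0.
set A := [set L2norm x | x in _].
have Aub z : A z -> 0 <= z <= 7 / Num.sqrt 8 * (- ln d)^-1.
  move=> [x [xH [x1 xd]] <-]; rewrite L2norm_ge0 /=.
  have := @log_stability R 1 d x; rewrite divr1 mulr1; apply => // j.
  exact: l2norm_ge.
rewrite ld [X in _ <= _ * X]ger0_norm ?invr_ge0 ?(ltW ld0)//.
(* On the empty set [sup] takes the default value 0, which satisfies the bound. *)
have [->|/set0P[z Az]] := eqVneq A set0.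
  by rewrite sup0 normr0 mulr_ge0 ?divr_ge0 ?sqrtr_ge0// invr_ge0 ltW.
have ubA : ubound A (7 / Num.sqrt 8 * (- ln d)^-1).
  by move=> w /Aub /andP[].
rewrite ger0_norm; first by apply: ge_sup => //; exists z.
have /andP[z0 _] := Aub z Az.
apply: le_trans z0 _; apply: ub_le_sup => //.
by exists (7 / Num.sqrt 8 * (- ln d)^-1).
Unshelve. all: by end_near. Qed.
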